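(* Let $A\in\mathbb{H}^{m\times n}$ have rank $\nu$, and let $W_1\in\mathbb{H}^{n\times m}$ be a matrix such that $\dim(\mathcal{R}_r(W_1))=s\le\nu$ and $\dim(\mathcal{N}_r(W_1))=m-s$. Let $W_1=S_1T_1$ be a full rank factorization of $W_1$. If $A$ has a $\{2\}$-inverse $A^{(2)}_{r,(W_1,W_1)}$, then: (a) $T_1AS_1$ is an invertible matrix. (b) With $X=S_1(T_1AS_1)^{-1}T_1$, one has $A^{(2)}_{r,(W_1,W_1)}=X=A^{(2)}_{r,(S_1,T_1)}$.
   Context: $\mathbb{H}$ denotes the real quaternions. For $B\in\mathbb{H}^{m\times n}$, $\mathcal{R}_r(B)=\{Bx : x\in\mathbb{H}^{n\times 1}\}$ and $\mathcal{N}_r(B)=\{x\in\mathbb{H}^{n\times 1} : Bx=0\}$ are the right range and right null space, and dimensions are dimensions of right quaternion vector spaces. The rank of $B$ is the maximal number of right linearly independent columns (equivalently, of left linearly independent rows). A full rank factorization of $W_1\in\mathbb{H}^{n\times m}$ of rank $s$ is a factorization $W_1=S_1T_1$ with $S_1\in\mathbb{H}^{n\times s}$, $T_1\in\mathbb{H}^{s\times m}$ and $\operatorname{rank}(S_1)=\operatorname{rank}(T_1)=s$. For $A\in\mathbb{H}^{m\times n}$, $A^{(2)}_{r,(S,T)}$ denotes the matrix $X\in\mathbb{H}^{n\times m}$ with $XAX=X$, $\mathcal{R}_r(X)=\mathcal{R}_r(S)$, $\mathcal{N}_r(X)=\mathcal{N}_r(T)$ (unique when it exists). *)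

(* Defs.v *)
From HB Require Import structures.
From mathcomp Require Import all_boot all_order all_algebra ring.
From mathcomp Require Import boolp classical_sets reals.

Set Implicit Arguments.
Unset Strict Implicit.
Unset Printing Implicit Defensive.

Import Order.TTheory GRing.Theory Num.Theory.
Local Open Scope ring_scope.
Local Open Scope classical_set_scope.

(* Quat a b c d stands for a + b i + c j + d k. *)
Record quat (R : realType) := Quat { qre : R; qi : R; qj : R; qk : R }.

Section QuaternionRing.
Variable R : realType.
Implicit Types x y z : quat R.

Definition quat_to_prod x := (qre x, qi x, qj x, qk x).
Definition prod_to_quat (p : R * R * R * R) :=
  Quat p.1.1.1 p.1.1.2 p.1.2 p.2.

Lemma quat_to_prodK : cancel quat_to_prod prod_to_quat.
Proof. by case. Qed.

HB.instance Definition _ := Choice.copy (quat R) (can_type quat_to_prodK).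

Definition quat_add x y :=
  Quat (qre x + qre y) (qi x + qi y) (qj x + qj y) (qk x + qk y).
Definition quat_opp x := Quat (- qre x) (- qi x) (- qj x) (- qk x).
Definition quat_zero : quat R := Quat 0 0 0 0.
Definition quat_one : quat R := Quat 1 0 0 0.

(* Hamilton product: i^2 = j^2 = k^2 = ijk = -1. *)
Definition quat_mul x y :=
  Quat (qre x * qre y - qi x * qi y - qj x * qj y - qk x * qk y)
       (qre x * qi y + qi x * qre y + qj x * qk y - qk x * qj y)
       (qre x * qj y - qi x * qk y + qj x * qre y + qk x * qi y)
       (qre x * qk y + qi x * qj y - qj x * qi y + qk x * qre y).

Lemma quat_addA : associative quat_add.
Proof. by move=> [????] [????] [????]; rewrite /quat_add /= !addrA. Qed.

Lemma quat_addC : commutative quat_add.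
Proof.
move=> [a b c d] [a' b' c' d']; rewrite /quat_add /=.
by congr Quat; rewrite addrC.
Qed.

Lemma quat_add0 : left_id quat_zero quat_add.
Proof. by move=> [????]; rewrite /quat_add /= !add0r. Qed.

Lemma quat_addN : left_inverse quat_zero quat_opp quat_add.
Proof. by move=> [????]; rewrite /quat_add /= !addNr. Qed.

HB.instance Definition _ :=
  GRing.isZmodule.Build (quat R) quat_addA quat_addC quat_add0 quat_addN.

Lemma quat_mulA : associative quat_mul.
Proof.
by move=> [????] [????] [????]; rewrite /quat_mul /=; congr Quat; ring.
Qed.

Lemma quat_mul1l : left_id quat_one quat_mul.
Proof. by move=> [????]; rewrite /quat_mul /=; congr Quat; ring. Qed.

Lemma quat_mul1r : right_id quat_one quat_mul.
Proof. by move=> [????]; rewrite /quat_mul /=; congr Quat; ring. Qed.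

Lemma quat_mulDl : left_distributive quat_mul quat_add.
Proof.
move=> [????] [????] [????]; rewrite /quat_mul /quat_add /=.
by congr Quat; ring.
Qed.

Lemma quat_mulDr : right_distributive quat_mul quat_add.
Proof.
move=> [????] [????] [????]; rewrite /quat_mul /quat_add /=.
by congr Quat; ring.
Qed.

Lemma quat_one_neq0 : quat_one != 0 :> quat R.
Proof. by apply/eqP => -[] /eqP; rewrite oner_eq0. Qed.

HB.instance Definition _ := GRing.Zmodule_isNzRing.Build (quat R)
  quat_mulA quat_mul1l quat_mul1r quat_mulDl quat_mulDr quat_one_neq0.

End QuaternionRing.

(* quat R is not commutative. The product B *m x of a matrix by a column has
   entries \sum_j B i j * x j 0, so it is the linear combination of the columns
   of B with coefficients acting on the right. The rank and determinant of the
   library require commutative scalars, hence the definitions below. *)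
Section QuaternionMatrices.
Variable R : realType.
Local Notation H := (quat R).

Definition rrange m n (B : 'M[H]_(m, n)) : set 'cV[H]_m :=
  [set B *m x | x in [set: 'cV[H]_n]].

Definition rnull m n (B : 'M[H]_(m, n)) : set 'cV[H]_n :=
  [set x | B *m x = 0].

Definition rindep_cols m n (B : 'M[H]_(m, n)) (J : {set 'I_n}) : Prop :=
  forall c : 'cV[H]_n,
    (forall j, j \notin J -> c j 0 = 0) -> B *m c = 0 -> c = 0.

Definition qrank m n (B : 'M[H]_(m, n)) : nat :=
  \max_(J : {set 'I_n} | `[< rindep_cols B J >]) #|J|.

(* U is a right subspace having a basis of d vectors, the columns of V. *)
Definition has_rdim n (U : set 'cV[H]_n) (d : nat) : Prop :=
  exists V : 'M[H]_(n, d), rindep_cols V [set: 'I_d]%SET /\ rrange V = U.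

Definition full_rank_factorization n m s
    (W : 'M[H]_(n, m)) (S : 'M[H]_(n, s)) (T : 'M[H]_(s, m)) : Prop :=
  [/\ qrank W = s, W = S *m T, qrank S = s & qrank T = s].

Definition is_mxinv n (M N : 'M[H]_n) : Prop :=
  M *m N = 1%:M /\ N *m M = 1%:M.

(* X is a {2}-inverse of A with right range that of S and right null space
   that of T. *)
Definition is_inv2 m n p q (A : 'M[H]_(m, n)) (S : 'M[H]_(n, p))
    (T : 'M[H]_(q, m)) (X : 'M[H]_(n, m)) : Prop :=
  [/\ X *m A *m X = X, rrange X = rrange S & rnull X = rnull T].

End QuaternionMatrices.

(* Main.v *)
(* A matrix T of rank s with s rows is onto: it restricts to an injective map on
   s coordinates, and over a division ring injectivity of a square matrix gives
   surjectivity. Hence W1 = S1 T1 has the range of S1 and, S1 being injective,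
   the null space of T1. If Z is the given {2}-inverse, then T1 v = T1 A Z v for
   all v, and Z A fixes the range of S1; the first fact makes T1 A S1 onto and
   the second, with the equality of the null spaces of Z and T1, injective. *)
Require Import Defs.
From mathcomp Require Import all_boot all_order all_algebra.
From mathcomp Require Import ring.
From mathcomp Require Import boolp classical_sets reals.

Set Implicit Arguments.
Unset Strict Implicit.
Unset Printing Implicit Defensive.

Import Order.TTheory GRing.Theory Num.Theory.

Local Open Scope ring_scope.

Lemma mulmx_cV_inj (D : nzRingType) (m n : nat) (A B : 'M[D]_(m, n)) :
  (forall v : 'cV_n, A *m v = B *m v) -> A = B.
Proof.
move=> AB; apply/matrixP => i j.
move/(congr1 (fun w : 'cV_m => w i 0)): (AB (delta_mx j 0)).
by rewrite -!colE !mxE.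
Qed.

Lemma surjective_right_inverse (D : nzRingType) (m n : nat) (A : 'M[D]_(m, n)) :
  (forall v : 'cV_m, exists x : 'cV_n, A *m x = v) ->
  exists N : 'M_(n, m), A *m N = 1%:M.
Proof.
move=> Asurj; have [f Af] := fin_all_exists (fun k => Asurj (delta_mx k 0)).
exists (\matrix_(i, k) f k i 0); apply/matrixP => i k.
move/(congr1 (fun w : 'cV_m => w i 0)): (Af k); rewrite !mxE eqxx andbT => <-.
by apply: eq_bigr => j _; rewrite !mxE.
Qed.

(** Surjectivity yields a right inverse [N]; since [M (N M - 1) = 0], injectivity of [M] makes [N] a
    left inverse too. *)
Lemma bijective_is_mxinv (R : realType) (n : nat) (M : 'M[quat R]_n) :
  (forall x : 'cV_n, M *m x = 0 -> x = 0) ->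
  (forall v : 'cV_n, exists x : 'cV_n, M *m x = v) ->
  exists N, is_mxinv M N.
Proof.
move=> Minj /surjective_right_inverse[N MN]; exists N; split => //.
apply: mulmx_cV_inj => v; apply/eqP; rewrite -subr_eq0; apply/eqP/Minj.
by rewrite mulmxBr !mulmxA MN mulmx1 mul1mx subrr.
Qed.

Section DivisionRing.
Variable D : nzRingType.
Hypothesis inv_exists : forall x : D, x != 0 -> exists y, x * y = 1.

(** Gaussian elimination by induction on the number of rows: one pivot removes a row and a column,
    and a solution of the smaller system extends by one coordinate. *)
Lemma wide_mx_kernel (m n : nat) (B : 'M[D]_(m, n)) :
  (m < n)%N -> exists2 x : 'cV_n, x != 0 & B *m x = 0.
Proof.
elim: m n B => [|m IHm] [|n] B // ltmn.
  exists (delta_mx 0 0); last by apply/matrixP => -[].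
  apply/eqP => /matrixP/(_ 0 0); rewrite !mxE eqxx => /eqP.
  by rewrite oner_eq0.
(* If the first row vanishes, [a = 0] makes the elimination step trivial. *)
have [j [a aP]] : exists j a, forall k, B 0 j * a * B 0 k = B 0 k.
  have [/existsP[j Bj]|/existsPn B0] := boolP [exists j, B 0 j != 0].
    have [a Ba] := inv_exists Bj.
    by exists j, a => k; rewrite Ba mul1r.
  exists 0, 0 => k; rewrite mulr0 mul0r.
  by apply/esym/eqP; have := B0 k; rewrite negbK.
(* From each lower row, [B i j * a] times the first row is subtracted, and column [j] is dropped. *)
pose B' : 'M_(m, n) := \matrix_(i, k)
  (B (lift 0 i) (lift j k) - B (lift 0 i) j * a * B 0 (lift j k)).
have [y y0 B'y] := IHm n B' ltmn.
pose t := \sum_k B 0 (lift j k) * y k 0.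
(* Coordinate [j] comes from solving the first equation: [B 0 j] times it cancels [t]. *)
pose x : 'cV_n.+1 :=
  \col_k (if unlift j k is Some k' then y k' 0 else - (a * t)).
have Bx i : (B *m x) i 0 =
    \sum_k B i (lift j k) * y k 0 - B i j * a * t.
  rewrite mxE (bigD1_ord j) //= mxE unlift_none mulrN mulrA addrC.
  by congr (_ - _); apply: eq_bigr => k _; rewrite mxE liftK.
exists x.
  apply: contra_neq y0 => x0; apply/matrixP => k l; rewrite (ord1 l).
  by move/matrixP/(_ (lift j k) 0): x0; rewrite !mxE liftK.
apply/matrixP => i l; rewrite (ord1 l) Bx [RHS]mxE.
have [i' ->|->] := unliftP 0 i; rewrite /t mulr_sumr -sumrB.
  move/matrixP/(_ i' 0): B'y; rewrite !mxE => B'y; rewrite -[RHS]B'y.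
  by apply: eq_bigr => k _; rewrite !mxE mulrBl !mulrA.
by apply: big1 => k _; rewrite mulrA aP subrr.
Qed.

(** The augmented matrix [(M | v)] is wide, so it kills some nonzero [(c, t)]. Injectivity of [M]
    forces [t != 0], and dividing by [t] on the right solves for [v]. *)
Lemma injective_mx_surjective (m n : nat) (M : 'M[D]_(m, n)) :
  (m <= n)%N -> (forall x : 'cV_n, M *m x = 0 -> x = 0) ->
  forall v : 'cV_m, exists x : 'cV_n, M *m x = v.
Proof.
move=> lemn Minj v.
have [|z z0] := @wide_mx_kernel m (n + 1) (row_mx M v); first by rewrite addn1.
rewrite -[z]vsubmxK mul_row_col [dsubmx z]mx11_scalar.
set c := usubmx z; set t := dsubmx z 0 0 => Mcvt.
have t0 : t != 0.
  apply: contra_neq z0 => t0; rewrite -[z]vsubmxK [dsubmx z]mx11_scalar -/t t0.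
  rewrite -/c (Minj c) ?raddf0 ?col_mx0 //.
  by move: Mcvt; rewrite t0 raddf0 mulmx0 addr0.
have [u tu] := inv_exists t0.
exists (- c *m u%:M); rewrite mulmxA mulmxN.
move/eqP: Mcvt; rewrite addrC addr_eq0 => /eqP <-.
by rewrite -mulmxA -scalar_mxM tu mulmx1.
Qed.

End DivisionRing.

Section QuaternionMatrices.
Variable R : realType.
Local Notation H := (quat R).

Lemma quat_inv_exists (x : H) : x != 0 -> exists y, x * y = 1.
Proof.
case: x => a b c d x0.
pose q := a ^+ 2 + b ^+ 2 + c ^+ 2 + d ^+ 2.
have q0 : q != 0.
  apply: contra_neq x0 => /eqP.
  rewrite !paddr_eq0 ?addr_ge0 ?sqr_ge0 // !sqrf_eq0.
  by case/andP => /andP[/andP[/eqP-> /eqP->] /eqP->] /eqP->.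
(* The conjugate divided by the squared norm. *)
exists (Quat (a / q) (- b / q) (- c / q) (- d / q)).
rewrite [LHS]/GRing.mul [RHS]/GRing.one /= /quat_mul /quat_one /=.
by congr Quat; rewrite /q; field.
Qed.

Lemma rindep_cols0 (m n : nat) (B : 'M[H]_(m, n)) :
  rindep_cols B finset.set0.
Proof.
move=> c c0 _; apply/matrixP => j k; rewrite (ord1 k) mxE c0 //.
by rewrite finset.in_set0.
Qed.

(** The empty set is independent, so the maximum runs over a nonempty family and has a maximizer. *)
Lemma qrank_attained (m n : nat) (B : 'M[H]_(m, n)) :
  exists2 J, rindep_cols B J & #|J| = qrank B.
Proof.
have P0 : `[< rindep_cols B finset.set0 >] by apply/asboolP/rindep_cols0.
rewrite /qrank (bigop.bigmax_eq_arg finset.set0) //.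
by case: arg_maxnP => // J /asboolP indJ _; exists J.
Qed.

Lemma full_col_rank_injective (m n : nat) (B : 'M[H]_(m, n)) :
  qrank B = n -> forall x : 'cV_n, B *m x = 0 -> x = 0.
Proof.
move=> rB x; have [J indJ cardJ] := qrank_attained B; apply: indJ => j.
have /eqP -> : J == [set: 'I_n]%SET.
  by rewrite eqEcard finset.subsetT cardsT card_ord cardJ rB leqnn.
by rewrite finset.in_setT.
Qed.

Lemma full_row_rank_surjective (m n : nat) (B : 'M[H]_(m, n)) :
  qrank B = m -> forall v : 'cV_m, exists x : 'cV_n, B *m x = v.
Proof.
move=> rB v; have [J indJ cardJ] := qrank_attained B.
(* [P] extends a vector indexed by [J] by zeros, so [B *m P] keeps the columns of [B] in [J]; it is
   square because [#|J| = m]. *)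
pose P : 'M[H]_(n, #|J|) := \matrix_(j, k) (j == enum_val k)%:R.
have Pval (y : 'cV_#|J|) k : (P *m y) (enum_val k) 0 = y k 0.
  rewrite mxE (bigD1 k) //= mxE eqxx mul1r big1 ?addr0 // => l lk.
  by rewrite mxE (inj_eq enum_val_inj) eq_sym (negbTE lk) mul0r.
have BPinj (y : 'cV_#|J|) : B *m P *m y = 0 -> y = 0.
  rewrite -mulmxA => /indJ Py0; apply/matrixP => k l.
  rewrite (ord1 l) -Pval Py0 ?mxE // => j jJ.
  rewrite mxE big1 // => i _; rewrite mxE.
  case: eqP jJ => [->|_ _]; last by rewrite mul0r.
  by rewrite enum_valP.
have [|x BPx] := injective_mx_surjective quat_inv_exists _ BPinj v.
  by rewrite cardJ rB.
by exists (P *m x); rewrite mulmxA.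
Qed.

Lemma rrange_mulmx (m n p : nat) (S : 'M[H]_(m, n)) (T : 'M[H]_(n, p)) :
  (forall v : 'cV_n, exists x : 'cV_p, T *m x = v) ->
  rrange (S *m T) = rrange S.
Proof.
move=> Tsurj; apply/seteqP; split => _ [x _ <-].
  by exists (T *m x) => //; rewrite mulmxA.
by have [y <-] := Tsurj x; exists y => //; rewrite mulmxA.
Qed.

Lemma rnull_mulmx (m n p : nat) (S : 'M[H]_(m, n)) (T : 'M[H]_(n, p)) :
  (forall x : 'cV_n, S *m x = 0 -> x = 0) -> rnull (S *m T) = rnull T.
Proof.
move=> Sinj; apply/seteqP; split => x; rewrite /rnull /= -mulmxA.
  exact: Sinj.
by move=> ->; rewrite mulmx0.
Qed.

(** [Z A] fixes every [Z u], and [S x] has this form because the ranges agree. *)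
Lemma is_inv2_range (m n p q : nat) (A : 'M[H]_(m, n))
    (S : 'M[H]_(n, p)) (T : 'M[H]_(q, m)) (Z : 'M[H]_(n, m)) (x : 'cV_p) :
  is_inv2 A S T Z -> Z *m A *m (S *m x) = S *m x.
Proof.
case=> ZAZ rZ _.
have /= : rrange S (S *m x) by exists x.
by rewrite -rZ => -[u _ <-]; rewrite mulmxA ZAZ.
Qed.

(** [A Z v - v] lies in the null space of [Z], which is that of [T]. *)
Lemma is_inv2_null (m n p q : nat) (A : 'M[H]_(m, n))
    (S : 'M[H]_(n, p)) (T : 'M[H]_(q, m)) (Z : 'M[H]_(n, m)) :
  is_inv2 A S T Z -> T *m A *m Z = T.
Proof.
case=> ZAZ _ nZ; apply: mulmx_cV_inj => v.
have /= : rnull Z (A *m Z *m v - v).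
  by rewrite /rnull /= mulmxBr !mulmxA ZAZ subrr.
rewrite nZ /rnull /= mulmxBr => /eqP; rewrite subr_eq0 => /eqP.
by rewrite !mulmxA.
Qed.

Lemma is_inv2_unique (m n p q : nat) (A : 'M[H]_(m, n))
    (S : 'M[H]_(n, p)) (T : 'M[H]_(q, m)) (Z Z' : 'M[H]_(n, m)) :
  is_inv2 A S T Z -> is_inv2 A S T Z' -> Z = Z'.
Proof.
move=> invZ invZ'; have [ZAZ rZ nZ] := invZ; have [Z'AZ' rZ' nZ'] := invZ'.
have Z'E : Z *m A *m Z' = Z'.
  apply: mulmx_cV_inj => v.
  have : rrange Z' (Z' *m v) by exists v.
  rewrite rZ' => -[x _ Sx].
  by rewrite -(mulmxA (Z *m A)) -Sx (is_inv2_range x invZ).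
(* [Z'] is also a {2}-inverse whose null space is that of [Z], so [Z] can take the role of [T],
   giving [Z A Z' = Z]. *)
rewrite -[RHS]Z'E; apply/esym/(@is_inv2_null _ _ _ _ _ S).
by split; rewrite // nZ nZ'.
Qed.

(** With [X = S N T], [N] being a left inverse gives [X A S = S], hence [X A X = X] and the range;
    [N] being a right inverse gives [T A X = T], hence the null space. *)
Lemma is_inv2_of_mxinv (m n s : nat) (A : 'M[H]_(m, n))
    (S : 'M[H]_(n, s)) (T : 'M[H]_(s, m)) (N : 'M[H]_s) :
  is_mxinv (T *m A *m S) N -> is_inv2 A S T (S *m N *m T).
Proof.
case=> MN NM.
have XAS : S *m N *m T *m A *m S = S.
  rewrite -(mulmxA _ T A) -(mulmxA _ (T *m A)) -(mulmxA S N).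
  by rewrite NM mulmx1.
split.
- by rewrite !mulmxA XAS.
- apply/seteqP; split => _ [x _ <-].
    by exists (N *m T *m x) => //; rewrite !mulmxA.
  exists (A *m S *m x) => //.
  by rewrite !mulmxA XAS.
apply/seteqP; split => x; rewrite /rnull /= => Tx0.
  have: T *m A *m (S *m N *m T *m x) = 0 by rewrite Tx0 mulmx0.
  by rewrite !mulmxA MN mul1mx.
by rewrite -mulmxA Tx0 mulmx0.
Qed.

Lemma is_inv2_mxinv_exists (m n s : nat) (A : 'M[H]_(m, n))
    (S : 'M[H]_(n, s)) (T : 'M[H]_(s, m)) (Z : 'M[H]_(n, m)) :
  (forall x : 'cV_s, S *m x = 0 -> x = 0) ->
  (forall v : 'cV_s, exists x : 'cV_m, T *m x = v) ->
  is_inv2 A S T Z -> exists N, is_mxinv (T *m A *m S) N.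
Proof.
move=> Sinj Tsurj invZ; have [_ rZ nZ] := invZ.
apply: bijective_is_mxinv => [x TASx0|v].
  apply: Sinj; rewrite -(is_inv2_range x invZ) -mulmxA.
  suff: rnull Z (A *m (S *m x)) by [].
  by rewrite nZ /rnull /= !mulmxA.
(* If [v = T u] and [Z u = S x], then [T A S x = T A Z u = T u = v]. *)
have [u <-] := Tsurj v.
have : rrange Z (Z *m u) by exists u.
rewrite rZ => -[x _ Sx]; exists x.
by rewrite -mulmxA Sx mulmxA (is_inv2_null invZ).
Qed.

End QuaternionMatrices.

Theorem theorem4p11 (R : realType) (m n nu s : nat)
    (A : 'M[quat R]_(m, n)) (W1 : 'M[quat R]_(n, m))
    (S1 : 'M[quat R]_(n, s)) (T1 : 'M[quat R]_(s, m))
    (rankA : qrank A = nu)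
    (s_le_nu : (s <= nu)%N)
    (dim_range : has_rdim (rrange W1) s)
    (dim_null : has_rdim (rnull W1) (m - s)%N)
    (W1_fact : full_rank_factorization W1 S1 T1)
    (A_inv2 : exists Z : 'M[quat R]_(n, m), is_inv2 A W1 W1 Z) :
  (exists N : 'M[quat R]_s, is_mxinv (T1 *m A *m S1) N) /\
  (forall N : 'M[quat R]_s, is_mxinv (T1 *m A *m S1) N ->
    let X := S1 *m N *m T1 in
    unique (is_inv2 A W1 W1) X /\ unique (is_inv2 A S1 T1) X).
Proof.
have [_ W1E rS1 rT1] := W1_fact.
have S1inj := full_col_rank_injective rS1.
have T1surj := full_row_rank_surjective rT1.
(* Both pairs prescribe the same range and null space, so one uniqueness argument serves for both
   inverses. *)
have inv2E Z : is_inv2 A W1 W1 Z = is_inv2 A S1 T1 Z.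
  by rewrite /is_inv2 W1E rrange_mulmx // rnull_mulmx.
have -> : is_inv2 A W1 W1 = is_inv2 A S1 T1 by apply/funext => Z.
case: A_inv2 => Z; rewrite inv2E => invZ.
split=> [|N /is_inv2_of_mxinv invX X]; first exact: is_inv2_mxinv_exists invZ.
by split; split=> // Z'; apply: is_inv2_unique.
Qed.
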